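(* Let $S$ be a join complete, strongly distributive skew lattice with $0$. Then $S$ is a noncommutative frame if and only if the lattice $S/\mathcal{D}$ is a frame.
   Context: A skew lattice is a set $S$ with two idempotent, associative binary operations $\land,\lor$ satisfying the absorption laws $x\land(x\lor y)=x=x\lor(x\land y)$ and $(x\land y)\lor y=y=(x\lor y)\land y$ (commutativity is not assumed). Natural partial order: $a\le b$ iff $a\land b=b\land a=a$ (equivalently $a\lor b=b=b\lor a$). The relation $\mathcal{D}$ on $S$: $a\,\mathcal{D}\,b$ iff $a\land b\land a=a$ and $b\land a\land b=b$. It is known that $\mathcal{D}$ is a congruence and that $S/\mathcal{D}$ is a lattice (the maximal lattice image, or commutative shadow, of $S$). Strongly distributive: $S$ satisfies $(x\lor y)\land z=(x\land z)\lor(y\land z)$ and $x\land(y\lor z)=(x\land y)\lor(x\land z)$ for all $x,y,z$. Skew lattice with $0$: there is a distinguished element $0$ with $x\lor 0=x=0\lor x$ for all $x$ (equivalently $x\land 0=0=0\land x$). A commuting subset of $S$ is a nonempty subset $\{x_i \mid i\in I\}$ such that $x_i\land x_j=x_j\land x_i$ and $x_i\lor x_j=x_j\lor x_i$ for all $i,j\in I$. $S$ is join complete if every commuting subset has a supremum with respect to the natural partial order; this supremum is denoted $\bigvee_i x_i$. A frame is a lattice that has all joins (finite and infinite) and satisfies $x\land\bigvee_i y_i=\bigvee_i(x\land y_i)$. A noncommutative frame is a strongly distributive, join complete skew lattice $A$ with $0$ that satisfies the infinite distributive laws $(\bigvee_i x_i)\land y=\bigvee_i(x_i\land y)$ and $x\land(\bigvee_i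 y_i)=\bigvee_i(x\land y_i)$ for all $x,y\in A$ and all commuting subsets $\{x_i \mid i\in I\},\{y_i \mid i\in I\}\subseteq A$, where all the joins are suprema with respect to the natural partial order. *)

(* Defs.v *)
From HB Require Import structures.
From mathcomp Require Import all_boot all_order.
From mathcomp Require Import classical_sets.

Set Implicit Arguments.
Unset Strict Implicit.
Unset Printing Implicit Defensive.

Import Order.Theory.
Local Open Scope order_scope.
Local Open Scope quotient_scope.
Local Open Scope classical_set_scope.

Declare Scope skew_scope.
Delimit Scope skew_scope with skew.
Local Open Scope skew_scope.

Reserved Notation "x <&> y" (at level 48, left associativity).
Reserved Notation "x <|> y" (at level 52, left associativity).

(* The order [<=] of a skew lattice is the natural partial order; it is
   determined by [smeet], see the factory [Choice_isSkewLattice] below.  It is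
   a field only so that the structure extends [porderType]. *)
HB.mixin Record POrder_isSkewLattice (d : Order.disp_t) S
    of Order.POrder d S := {
  smeet : S -> S -> S;
  sjoin : S -> S -> S;
  smeetxx : forall x, smeet x x = x;
  sjoinxx : forall x, sjoin x x = x;
  smeetA : associative smeet;
  sjoinA : associative sjoin;
  smeetKUl : forall x y, smeet x (sjoin x y) = x;
  sjoinKIl : forall x y, sjoin x (smeet x y) = x;
  sjoinKIr : forall x y, sjoin (smeet x y) y = y;
  smeetKUr : forall x y, smeet (sjoin x y) y = y;
  leEsmeet : forall a b : S, (a <= b) = (smeet a b == a) && (smeet b a == a)
}.

#[short(type="skewLatticeType")]
HB.structure Definition SkewLattice (d : Order.disp_t) :=
  { S of POrder_isSkewLattice d S & Order.POrder d S }.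

Notation "x <&> y" := (smeet x y) : skew_scope.
Notation "x <|> y" := (sjoin x y) : skew_scope.

HB.factory Record Choice_isSkewLattice (d : Order.disp_t) S of Choice S := {
  smeet : S -> S -> S;
  sjoin : S -> S -> S;
  smeetxx : forall x, smeet x x = x;
  sjoinxx : forall x, sjoin x x = x;
  smeetA : associative smeet;
  sjoinA : associative sjoin;
  smeetKUl : forall x y, smeet x (sjoin x y) = x;
  sjoinKIl : forall x y, sjoin x (smeet x y) = x;
  sjoinKIr : forall x y, sjoin (smeet x y) y = y;
  smeetKUr : forall x y, smeet (sjoin x y) y = y
}.

HB.builders Context d S of Choice_isSkewLattice d S.

Let le (a b : S) := (smeet a b == a) && (smeet b a == a).

Let le_refl : reflexive le.
Proof. by move=> x; rewrite /le smeetxx eqxx. Qed.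

Let le_anti : antisymmetric le.
Proof.
by move=> x y /andP[/andP[/eqP xy _] /andP[_ /eqP yx]]; rewrite -xy yx.
Qed.

Let le_trans : transitive le.
Proof.
move=> y x z /andP[/eqP xy /eqP yx] /andP[/eqP yz /eqP zy]; apply/andP; split.
  by rewrite -[X in smeet X z]xy -smeetA yz xy.
by rewrite -[X in smeet z X]yx smeetA zy yx.
Qed.

HB.instance Definition _ :=
  @Order.Le_isPOrder.Build d S le le_refl le_anti le_trans.
HB.instance Definition _ := @POrder_isSkewLattice.Build d S smeet sjoin
  smeetxx sjoinxx smeetA sjoinA smeetKUl sjoinKIl sjoinKIr smeetKUr
  (fun _ _ => erefl).

HB.end.

HB.mixin Record SkewLattice_hasZero (d : Order.disp_t) S
    of SkewLattice d S := {
  szero : S;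
  sjoinx0 : forall x : S, x <|> szero = x;
  sjoin0x : forall x : S, szero <|> x = x
}.

#[short(type="skewLattice0Type")]
HB.structure Definition SkewLattice0 (d : Order.disp_t) :=
  { S of SkewLattice_hasZero d S & SkewLattice d S }.

Definition strongly_distributive d (S : skewLatticeType d) : Prop :=
  (forall x y z : S, (x <|> y) <&> z = (x <&> z) <|> (y <&> z)) /\
  (forall x y z : S, x <&> (y <|> z) = (x <&> y) <|> (x <&> z)).

Definition commuting_subset d (S : skewLatticeType d) (X : set S) : Prop :=
  X !=set0 /\
  (forall x y, X x -> X y -> x <&> y = y <&> x /\ x <|> y = y <|> x).

Definition join_complete d (S : skewLatticeType d) : Prop :=
  forall X : set S, commuting_subset X -> supremums X !=set0.

(* An equation between joins is read as: the right-hand supremum exists and is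
   the left-hand element, i.e. the latter belongs to [supremums _].  The family
   (y_i) is represented by the set of its values. *)
Definition noncommutative_frame d (A : skewLattice0Type d) : Prop :=
  [/\ strongly_distributive A,
      join_complete A,
      forall (X : set A) (s y : A), commuting_subset X -> supremums X s ->
        supremums [set x <&> y | x in X] (s <&> y)
    & forall (x : A) (Y : set A) (s : A), commuting_subset Y ->
        supremums Y s -> supremums [set x <&> y | y in Y] (x <&> s)].

Definition is_frame d (L : latticeType d) : Prop :=
  (forall Y : set L, supremums Y !=set0) /\
  (forall (x : L) (Y : set L) (s : L), supremums Y s ->
     supremums [set (x `&` y)%O | y in Y] (x `&` s)%O).

Section Band.
Variables (T : Type) (m : T -> T -> T).
Hypotheses (mxx : forall x, m x x = x) (mA : associative m).

Local Notation ble x y := (m (m x y) x = x).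

Let m_shift x a b : x = m a b -> m (m x (m b a)) x = x.
Proof.
by move=> ->; rewrite !mA -(mA a b b) mxx -(mA (m a b) a a) mxx
                 -(mA (m a b) a b) mxx.
Qed.

Lemma ble_factor x u f v : x = m (m u f) v -> m (m x f) x = x.
Proof.
move=> xE.
have e1 : x = m (m x f) (m (m v u) x).
  have := @m_shift x u (m f v); rewrite mA => /(_ xE).
  by rewrite !mA => /esym.
have := m_shift e1; rewrite !mA => e2.
have e3 : m (m (m x v) u) (m (m x f) x) = x.
  by rewrite -{4}e2 !mA -(mA _ x x) mxx.
rewrite -[in RHS]e3 -[in RHS](mxx (m (m x f) x)) [in RHS]mA e3.
by rewrite !mA mxx.
Qed.

Lemma ble_trans x y z : ble x y -> ble y z -> ble x z.
Proof.
move=> xy yz; apply: (@ble_factor _ (m x y) z (m y x)).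
by rewrite -[LHS]xy -[in LHS]yz !mA.
Qed.

Lemma ble_ml x y : ble (m x y) x.
Proof. by apply: (@ble_factor _ x x y); rewrite mxx. Qed.

Lemma ble_mr x y : ble (m x y) y.
Proof. by apply: (@ble_factor _ x y y); rewrite -mA mxx. Qed.

Lemma ble_glb x a b : ble x a -> ble x b -> ble x (m a b).
Proof.
move=> xa xb.
apply: (@ble_factor _ (m x (m b x)) (m a b) (m x (m a x))).
have e : x = m (m x (m (m b x) a)) x by rewrite !mA xb xa.
by rewrite [LHS]e -[X in m (m x X) x]mxx !mA.
Qed.

Lemma ble_mono a a' b b' : ble a a' -> ble b b' -> ble (m a b) (m a' b').
Proof.
by move=> aa bb; apply: ble_glb;
  [apply: ble_trans aa; apply: ble_ml | apply: ble_trans bb; apply: ble_mr].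
Qed.

End Band.

(* Absorption reverses the preorders of the bands (S, meet) and (S, join), so
   that D can be defined with either operation. *)
Section BandDual.
Variables (T : Type) (m j : T -> T -> T).
Hypotheses (jxx : forall x, j x x = x) (jA : associative j).
Hypotheses (mA : associative m).
Hypotheses (jKl : forall x y, j x (m x y) = x).
Hypotheses (jKr : forall x y, j (m x y) y = y).

Lemma ble_dual x y : m (m x y) x = x -> j (j y x) y = y.
Proof.
move=> xy; apply: (@ble_factor _ j jxx jA _ y x (m y x)).
have e : j x (m y x) = m y x by rewrite -{1}xy -mA jKr.
by rewrite -jA e jKl.
Qed.

End BandDual.

Section Shadow.
Context {d : Order.disp_t} (S : skewLatticeType d).
Implicit Types x y z a b : S.

Definition Drel : rel S :=
  fun a b => (a <&> b <&> a == a) && (b <&> a <&> b == b).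

Local Notation mle a b := (a <&> b <&> a = a).
Let mle_trans a b c : mle a b -> mle b c -> mle a c.
Proof. exact: (ble_trans smeetxx smeetA). Qed.

Lemma DrelP a b : reflect (mle a b /\ mle b a) (Drel a b).
Proof. by apply: (iffP andP) => -[/eqP ? /eqP ?]. Qed.

Fact Drel_refl : reflexive Drel.
Proof. by move=> x; rewrite /Drel !smeetxx eqxx. Qed.

Fact Drel_sym : symmetric Drel.
Proof. by move=> x y; rewrite /Drel andbC. Qed.

Fact Drel_trans : transitive Drel.
Proof.
by move=> y x z /DrelP[xy yx] /DrelP[yz zy]; apply/DrelP;
  split; [apply: mle_trans yz | apply: mle_trans yx].
Qed.

Canonical Drel_equiv := EquivRel Drel Drel_refl Drel_sym Drel_trans.

Lemma DrelPj a b :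
  reflect (a <|> b <|> a = a /\ b <|> a <|> b = b) (Drel a b).
Proof.
apply: (iffP (DrelP _ _)) => -[h1 h2]; split.
- exact: (ble_dual sjoinxx sjoinA smeetA sjoinKIl sjoinKIr).
- exact: (ble_dual sjoinxx sjoinA smeetA sjoinKIl sjoinKIr).
- exact: (ble_dual smeetxx smeetA sjoinA smeetKUl smeetKUr).
- exact: (ble_dual smeetxx smeetA sjoinA smeetKUl smeetKUr).
Qed.

Lemma Drel_smeet a a' b b' :
  Drel a a' -> Drel b b' -> Drel (a <&> b) (a' <&> b').
Proof.
by move=> /DrelP[? ?] /DrelP[? ?]; apply/DrelP;
  split; apply: (ble_mono smeetxx smeetA).
Qed.

Lemma Drel_sjoin a a' b b' :
  Drel a a' -> Drel b b' -> Drel (a <|> b) (a' <|> b').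
Proof.
by move=> /DrelPj[? ?] /DrelPj[? ?]; apply/DrelPj;
  split; apply: (ble_mono sjoinxx sjoinA).
Qed.

Lemma Drel_smeetC a b : Drel (a <&> b) (b <&> a).
Proof.
by apply/DrelP; split; apply: (ble_glb smeetxx smeetA);
  (apply: (ble_ml smeetxx smeetA) || apply: (ble_mr smeetxx smeetA)).
Qed.

Lemma Drel_sjoinC a b : Drel (a <|> b) (b <|> a).
Proof.
by apply/DrelPj; split; apply: (ble_glb sjoinxx sjoinA);
  (apply: (ble_ml sjoinxx sjoinA) || apply: (ble_mr sjoinxx sjoinA)).
Qed.

Definition shadow := {eq_quot Drel_equiv}.

HB.instance Definition _ := Choice.on shadow.
HB.instance Definition _ := EqQuotient.on shadow.

Implicit Types p q r : shadow.

Lemma pi_shadow a b : \pi_shadow a = \pi_shadow b <-> Drel a b.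
Proof.
by split=> [/eqP|h]; [|apply/eqP]; rewrite (@pi_eq_quot _ Drel shadow).
Qed.

Definition shadow_meet p q : shadow := \pi_shadow (repr p <&> repr q).
Definition shadow_join p q : shadow := \pi_shadow (repr p <|> repr q).

Let Drel_repr a : Drel (repr (\pi_shadow a)) a.
Proof. by apply/pi_shadow; rewrite reprK. Qed.

Let pi_meetE a b :
  shadow_meet (\pi_shadow a) (\pi_shadow b) = \pi_shadow (a <&> b).
Proof. by apply/pi_shadow/Drel_smeet. Qed.

Let pi_joinE a b :
  shadow_join (\pi_shadow a) (\pi_shadow b) = \pi_shadow (a <|> b).
Proof. by apply/pi_shadow/Drel_sjoin. Qed.

Fact shadow_meetC : commutative shadow_meet.
Proof. by move=> p q; apply/pi_shadow/Drel_smeetC. Qed.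

Fact shadow_joinC : commutative shadow_join.
Proof. by move=> p q; apply/pi_shadow/Drel_sjoinC. Qed.

Fact shadow_meetA : associative shadow_meet.
Proof.
elim/quotW=> a; elim/quotW=> b; elim/quotW=> c.
by rewrite (pi_meetE b c) (pi_meetE a b) 2!pi_meetE smeetA.
Qed.

Fact shadow_joinA : associative shadow_join.
Proof.
elim/quotW=> a; elim/quotW=> b; elim/quotW=> c.
by rewrite (pi_joinE b c) (pi_joinE a b) 2!pi_joinE sjoinA.
Qed.

Fact shadow_meetxx : idempotent_op shadow_meet.
Proof. by elim/quotW=> a; rewrite pi_meetE smeetxx. Qed.

Fact shadow_joinKI q p : shadow_meet p (shadow_join p q) = p.
Proof.
elim/quotW: p => a; elim/quotW: q => b.
by rewrite (pi_joinE a b) pi_meetE smeetKUl.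
Qed.

Fact shadow_meetKU q p : shadow_join p (shadow_meet p q) = p.
Proof.
elim/quotW: p => a; elim/quotW: q => b.
by rewrite (pi_meetE a b) pi_joinE sjoinKIl.
Qed.

Definition shadow_le p q := shadow_meet p q == p.

Fact shadow_le_refl : reflexive shadow_le.
Proof. by move=> p; rewrite /shadow_le shadow_meetxx. Qed.

Fact shadow_le_anti : antisymmetric shadow_le.
Proof.
by move=> p q /andP[/eqP pq /eqP qp]; rewrite -[LHS]pq shadow_meetC.
Qed.

Fact shadow_le_trans : transitive shadow_le.
Proof.
move=> q p r /eqP pq /eqP qr; apply/eqP.
by rewrite -[X in shadow_meet X r]pq -shadow_meetA qr.
Qed.

HB.instance Definition _ := @Order.Le_isPOrder.Build d shadow shadow_le
  shadow_le_refl shadow_le_anti shadow_le_trans.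

HB.instance Definition _ := @Order.POrder_isLattice.Build d shadow
  shadow_meet shadow_join shadow_meetC shadow_joinC shadow_meetA shadow_joinA
  shadow_joinKI shadow_meetKU (fun _ _ => erefl).

Lemma pi_smeet : {morph \pi_shadow : a b / a <&> b >-> (a `&` b)%O}.
Proof. by move=> a b; rewrite -pi_meetE. Qed.

Lemma pi_sjoin : {morph \pi_shadow : a b / a <|> b >-> (a `|` b)%O}.
Proof. by move=> a b; rewrite -pi_joinE. Qed.

End Shadow.

(* Main.v *)
(* Elements below a common [m] commute, and on the principal ideal of [m] the
   projection to the shadow reflects the order.  Hence the projection preserves
   suprema of commuting subsets, and an upper bound of a commuting subset that
   projects onto the supremum of the image is itself a supremum: the infinite
   distributive laws can be moved up and down along the projection.  Moreover
   Zorn's lemma gives a maximal element, whose principal ideal meets every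
   D-class; so every subset of the shadow lifts to a commuting subset. *)
Require Import Defs.
From mathcomp Require Import all_boot all_order.
From mathcomp Require Import classical_sets.

Set Implicit Arguments.
Unset Strict Implicit.
Unset Printing Implicit Defensive.

Import Order.Theory.
Local Open Scope order_scope.
Local Open Scope quotient_scope.
Local Open Scope classical_set_scope.
Local Open Scope skew_scope.

Lemma le_smeetP d (S : skewLatticeType d) (a b : S) :
  a <= b <-> a <&> b = a /\ b <&> a = a.
Proof.
by rewrite leEsmeet; split=> [/andP[/eqP ? /eqP ?]|[-> ->]]; rewrite ?eqxx.
Qed.

Lemma le_sjoinP d (S : skewLatticeType d) (a b : S) :
  a <= b <-> a <|> b = b /\ b <|> a = b.
Proof.
rewrite le_smeetP; split=> -[ab ba]; split.
- by rewrite -{1}ab sjoinKIr.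
- by rewrite -{1}ba sjoinKIl.
- by rewrite -{1}ab smeetKUl.
- by rewrite -{1}ba smeetKUr.
Qed.

Lemma conj_smeet_le d (S : skewLatticeType d) (a b : S) : a <&> b <&> a <= a.
Proof. by apply/le_smeetP; rewrite -!smeetA smeetxx !smeetA smeetxx. Qed.

Lemma le_pi_shadow d (S : skewLatticeType d) (a b : S) :
  (\pi_(shadow S) a <= \pi_(shadow S) b) <-> a <&> b <&> a = a.
Proof.
rewrite leEmeet -pi_smeet; split=> [/eqP/pi_shadow/DrelP[_ h]|h].
  by rewrite -[RHS]h smeetA smeetxx.
by apply/eqP/pi_shadow/DrelP; split; rewrite ?h smeetA smeetxx.
Qed.

Lemma pi_shadow_homo d (S : skewLatticeType d) :
  {homo \pi_(shadow S) : a b / a <= b}.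
Proof.
by move=> a b /le_smeetP[ab _]; apply/le_pi_shadow; rewrite ab smeetxx.
Qed.

Lemma pi_conj_smeet d (S : skewLatticeType d) (a b : S) :
  \pi_(shadow S) (a <&> b <&> a) = (\pi_(shadow S) a `&` \pi_(shadow S) b)%O.
Proof. by rewrite !pi_smeet meetAC meetxx. Qed.

(* Absorption makes [a] a lower bound of [a <|> b <|> a], so a maximal [a] lies
   in the top D-class. *)
Lemma maximal_pi_shadow_top d (S : skewLatticeType d) (a : S) :
  (forall b, a <= b -> b = a) -> forall p : shadow S, p <= \pi_(shadow S) a.
Proof.
move=> amax; elim/quotW=> b.
have ab : a <|> b <|> a = a.
  by apply: amax; apply/le_smeetP; rewrite -sjoinA smeetKUl sjoinA smeetKUr.
have e : \pi_(shadow S) a = (\pi_(shadow S) a `|` \pi_(shadow S) b)%O.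
  by rewrite -{1}ab !pi_sjoin joinAC joinxx.
by rewrite e leUr.
Qed.

(** Both sides equal [x <&> y <&> x]: distributing in [x <&> (y <|> m) = x] and
    [(m <|> y) <&> x = x] shows that [x] absorbs [x <&> y] and [y <&> x] under join. *)
Lemma smeet_comm_below d (S : skewLatticeType d) (m x y : S) :
  strongly_distributive S -> x <= m -> y <= m -> x <&> y = y <&> x.
Proof.
move=> [dl dr] xm ym.
have [xmx mxx] := (le_smeetP x m).1 xm.
have [ymj myj] := (le_sjoinP y m).1 ym.
have e1 : (x <&> y) <|> x = x by rewrite -{2}xmx -dr ymj.
have e2 : x <|> (y <&> x) = x by rewrite -{1}mxx -dl myj.
transitivity (x <&> y <&> x).
  by rewrite -{3}e1 smeetKUl.
by rewrite -smeetA -{1}e2 smeetKUr.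
Qed.

(** For commuting elements the preorder [x <&> y <&> x = x] behind the shadow reduces to
    [x <&> y = x]. *)
Lemma le_pi_shadow_below d (S : skewLatticeType d) (m x y : S) :
  strongly_distributive S -> x <= m -> y <= m ->
  \pi_(shadow S) x <= \pi_(shadow S) y -> x <= y.
Proof.
move=> sd xm ym /le_pi_shadow xyx.
have xyC := smeet_comm_below sd xm ym.
by apply/le_smeetP; rewrite -xyC; split;
  rewrite -[RHS]xyx -smeetA -xyC smeetA smeetxx.
Qed.

Lemma le_of_pi_shadow_ge d (S : skewLatticeType d) (x y : S) :
  strongly_distributive S -> x <= y ->
  \pi_(shadow S) y <= \pi_(shadow S) x -> x = y.
Proof.
move=> sd xy yx; apply: le_anti; rewrite xy /=.
exact: (le_pi_shadow_below sd (lexx y)).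
Qed.

Lemma sjoin_le d (S : skewLatticeType d) (m x y : S) :
  strongly_distributive S -> x <= m -> y <= m -> x <|> y <= m.
Proof.
move=> [dl dr] /le_smeetP[xm mx] /le_smeetP[ym my].
by apply/le_smeetP; rewrite dl dr xm mx ym my.
Qed.

Lemma bounded_commuting d (S : skewLatticeType d) (X : set S) (m : S) :
  strongly_distributive S -> X !=set0 -> ubound X m -> commuting_subset X.
Proof.
move=> sd X0 Xm; split=> // x y /Xm xm /Xm ym.
split; first exact: smeet_comm_below sd xm ym.
(* Both joins lie below [m] and have the same image, so order reflection identifies them. *)
have pixy : \pi_(shadow S) (x <|> y) = \pi_(shadow S) (y <|> x).
  by rewrite !pi_sjoin joinC.
have [xy yx] := (sjoin_le sd xm ym, sjoin_le sd ym xm).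
apply/le_anti/andP; split.
  by apply: le_pi_shadow_below sd xy yx _; rewrite pixy.
by apply: le_pi_shadow_below sd yx xy _; rewrite pixy.
Qed.

Lemma supremums_pi_shadow d (S : skewLatticeType d) (X : set S) (s : S) :
  strongly_distributive S -> supremums X s ->
  supremums (\pi_(shadow S) @` X) (\pi_(shadow S) s).
Proof.
move=> sd [sub slub]; split=> [_ [x /sub xs <-]|]; first exact: pi_shadow_homo.
elim/quotW=> b bub.
(* The representative [b] is replaced by [s <&> b <&> s], which lies below [s] and projects onto the
   meet of the two classes. *)
suff /pi_shadow_homo : s <= s <&> b <&> s.
  by rewrite pi_conj_smeet lexI => /andP[].
apply: slub => x Xx; have xs := sub x Xx.
apply: (le_pi_shadow_below sd xs (conj_smeet_le s b)).
by rewrite pi_conj_smeet lexI pi_shadow_homo //; apply: bub; exists x.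
Qed.

(** The bound [s] makes [X] commuting, so [X] has a supremum [t <= s]; it lies in the D-class of
    [s], and comparable D-equivalent elements coincide. *)
Lemma supremums_of_pi_shadow d (S : skewLatticeType d) (X : set S) (s : S) :
  strongly_distributive S -> join_complete S -> X !=set0 -> ubound X s ->
  supremums (\pi_(shadow S) @` X) (\pi_(shadow S) s) -> supremums X s.
Proof.
move=> sd jc X0 Xs [_ pislub].
have [t tsup] := jc X (bounded_commuting sd X0 Xs).
have ts : t <= s by apply: tsup.2.
suff <- : t = s by [].
apply: le_of_pi_shadow_ge => //; apply: pislub.
by case: (supremums_pi_shadow sd tsup).
Qed.

Lemma le_smeet2r d (S : skewLatticeType d) (x y z : S) :
  strongly_distributive S -> x <= y -> x <&> z <= y <&> z.
Proof.
by move=> [dl _] /le_sjoinP[xy yx]; apply/le_sjoinP; rewrite -!dl xy yx.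
Qed.

Lemma le_smeet2l d (S : skewLatticeType d) (x y z : S) :
  strongly_distributive S -> x <= y -> z <&> x <= z <&> y.
Proof.
by move=> [_ dr] /le_sjoinP[xy yx]; apply/le_sjoinP; rewrite -!dr xy yx.
Qed.

Lemma szero_le d (S : skewLattice0Type d) (x : S) : szero <= x.
Proof. by apply/le_sjoinP; rewrite sjoinx0 sjoin0x. Qed.

Lemma exists_maximal d (S : skewLattice0Type d) :
  join_complete S -> exists m : S, forall x, m <= x -> x = m.
Proof.
move=> jc; apply: Zorn => [x|x y z|x y xy yx|A Atot] //.
- exact: le_trans.
- by apply: le_anti; rewrite xy yx.
(* The empty chain is bounded by [szero]; any other chain is a commuting subset, bounded by its
   supremum. *)
have [->|/set0P A0] := eqVneq A set0; first by exists szero.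
have [|s [sub _]] := jc A; last by exists s.
split=> // x y Ax Ay; case: (Atot x y Ax Ay) => h;
  by have [[-> ->] [-> ->]] := ((le_smeetP _ _).1 h, (le_sjoinP _ _).1 h).
Qed.

Lemma exists_commuting_lift d (S : skewLattice0Type d) (Y : set (shadow S)) :
  strongly_distributive S -> join_complete S -> Y !=set0 ->
  exists2 X : set S, commuting_subset X & \pi_(shadow S) @` X = Y.
Proof.
move=> sd jc [p Yp]; have [m mmax] := exists_maximal jc.
pose X := [set x : S | x <= m /\ Y (\pi_(shadow S) x)].
have lift q : Y q -> exists2 x, X x & \pi_(shadow S) x = q.
  elim/quotW: q => a Ya.
  (* The class of [m] is the top, so conjugation by [m] moves [a] below [m] inside its own class. *)
  have e : \pi_(shadow S) (m <&> a <&> m) = \pi_(shadow S) a.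
    rewrite pi_conj_smeet meetC; apply/eqP.
    by rewrite -leEmeet maximal_pi_shadow_top.
  by exists (m <&> a <&> m) => //; split; [apply: conj_smeet_le | rewrite e].
exists X; last by apply/seteqP; split=> [_ [x [_ Yx] <-]|] //.
have [x Xx _] := lift p Yp.
by apply: (bounded_commuting sd (m := m)); [exists x | move=> ? []].
Qed.

Theorem theorem5p1 (d : Order.disp_t) (S : skewLattice0Type d)
    (S_join_complete : join_complete S)
    (S_strongly_distributive : strongly_distributive S) :
  noncommutative_frame S <-> is_frame (shadow S).
Proof.
have [sd jc] := (S_strongly_distributive, S_join_complete).
split=> [[_ _ _ distr]|[_ distr]].
- have bot (p : shadow S) : \pi_(shadow S) szero <= p.
    by elim/quotW: p => a; apply/pi_shadow_homo/szero_le.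
  split=> [Y|p Y s supY].
    have [->|/set0P Y0] := eqVneq Y set0.
      by exists (\pi_(shadow S) szero); split=> // p _; apply: bot.
    have [X Xc <-] := exists_commuting_lift sd jc Y0.
    have [s supX] := jc X Xc.
    by exists (\pi_(shadow S) s); apply: supremums_pi_shadow.
  (* The empty family is not a commuting subset; its join is the bottom class, and so is the meet of
     [p] with it. *)
  have [Y0|/set0P Y0] := eqVneq Y set0.
    rewrite Y0 image_set0; split=> // q _; apply: le_trans (bot q).
    by apply: leIxr; apply: supY.2; rewrite Y0.
  have [X Xc XY] := exists_commuting_lift sd jc Y0.
  have [t supX] := jc X Xc.
  have -> : s = \pi_(shadow S) t.
    apply: is_subset1_supremums supY _.
    by rewrite -XY; apply: supremums_pi_shadow.
  (* The infinite law of [S], applied to a representative [a] of [p] and to the lift [X], is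
     projected to the shadow. *)
  elim/quotW: p => a; rewrite -XY -image_comp /= -pi_smeet.
  have := supremums_pi_shadow sd (distr a X t Xc supX).
  rewrite !image_comp; congr (supremums _ _).
  by apply: eq_imagel => x _ /=; rewrite pi_smeet.
- split=> // [X s y Xc supX|x Y s Yc supY].
  (* Monotonicity bounds the image by [s <&> y], so the supremum can be checked in the shadow, where
     commutativity of the meet gives the frame law on this side too. *)
  + apply: supremums_of_pi_shadow => //; first exact: image_nonempty Xc.1.
      by move=> _ [x /supX.1 xs <-]; apply: le_smeet2r.
    have := distr (\pi_(shadow S) y) _ _ (supremums_pi_shadow sd supX).
    rewrite !image_comp pi_smeet meetC; congr (supremums _ _).
    by apply: eq_imagel => x _ /=; rewrite pi_smeet meetC.
  + apply: supremums_of_pi_shadow => //; first exact: image_nonempty Yc.1.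
      by move=> _ [y /supY.1 ys <-]; apply: le_smeet2l.
    have := distr (\pi_(shadow S) x) _ _ (supremums_pi_shadow sd supY).
    rewrite !image_comp pi_smeet; congr (supremums _ _).
    by apply: eq_imagel => y _ /=; rewrite pi_smeet.
Qed.
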